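(* For any $n\ge 2$, any $\rho>0$ and any $1\le k\le n-1$, there exist $m$, $C\in\mathbb S^n$, a linear map $\mathcal A:\mathbb S^n\to\mathbb R^m$ and $b\in\mathbb R^m$ such that (P) is primal simple with a rank one solution, and there is some $y\in\mathbb R^m$ such that (AL-BM), with factor size $n\times k$, admits a spurious local minimizer $\hat F\in\mathbb R^{n\times k}$ of rank $k$ with $\mathcal A(\hat F\hat F^\top)=b$.
   Context: $\mathbb S^n$: real symmetric $n\times n$ matrices with the trace inner product. $\mathcal A^*$ is the adjoint of $\mathcal A$; $Z(y)=C-\mathcal A^*y$. (P): minimize $\langle C,X\rangle$ subject to $\mathcal AX=b$, $X\succeq0$. (D): maximize $\langle b,y\rangle$ subject to $Z(y)\succeq0$. (AL-BM): minimize over $F\in\mathbb R^{n\times k}$ the function $\bar{\mathcal L}_\rho(F,y)=\langle C,FF^\top\rangle+\langle y,b-\mathcal A(FF^\top)\rangle+\frac\rho2\|\mathcal A(FF^\top)-b\|_2^2$. (P) is primal simple if: strong duality holds (an optimal primal-dual pair exists and $\langle C,X\rangle=\langle b,y\rangle$ for any optimal pair $(X,y)$); some optimal pair $(X_\star,y_\star)$ satisfies strict complementarity $\operatorname{rank}(X_\star)+\operatorname{rank}(Z(y_\star))=n$; and the primal solution is unique. A spurious local minimizer is a local minimizer that is not a global minimizer. *)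

(* Defs.v *)
From HB Require Import structures.
From mathcomp Require Import all_boot all_order all_algebra.
From mathcomp Require Import boolp classical_sets reals topology normedtype.

Set Implicit Arguments.
Unset Strict Implicit.
Unset Printing Implicit Defensive.
Set Warnings "-redundant-canonical-projection".

Import Order.TTheory GRing.Theory Num.Theory.
Import numFieldNormedType.Exports.

Local Open Scope classical_set_scope.
Local Open Scope ring_scope.

Section SymmetricMatrices.
Variables (R : realType) (n : nat).

Definition symmetric : {pred 'M[R]_n} := fun X => X^T == X.

Fact symmetric_submod_closed : submod_closed symmetric.
Proof.
split; first by rewrite unfold_in trmx0.
by move=> a X Y /eqP hX /eqP hY; rewrite unfold_in linearP /= hX hY.
Qed.

HB.instance Definition _ :=
  GRing.isSubmodClosed.Build R 'M[R]_n symmetric symmetric_submod_closed.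

Record symmx := SymMx { smval :> 'M[R]_n; smvalP : smval \in symmetric }.

HB.instance Definition _ := [isSub for smval].
HB.instance Definition _ := [Choice of symmx by <:].
HB.instance Definition _ := [SubChoice_isSubZmodule of symmx by <:].
HB.instance Definition _ := [SubZmodule_isSubLmodule of symmx by <:].

Fact smval_is_linear : linear smval.
Proof. by move=> a X Y; exact: (linearP (val : symmx -> 'M[R]_n)). Qed.

HB.instance Definition _ :=
  GRing.isLinear.Build R symmx 'M[R]_n *:%R smval smval_is_linear.

End SymmetricMatrices.

(* \tr (U^T *m V) is the trace inner product on matrices; on column vectors it
   is the Euclidean inner product of R^m. *)
Definition inner (R : realType) (m n : nat) (U V : 'M[R]_(m, n)) : R :=
  \tr (U^T *m V).

Definition psd (R : realType) (n : nat) (X : symmx R n) : Prop :=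
  forall v : 'cV[R]_n, 0 <= inner v (X *m v).

Section Gram.
Variables (R : realType) (n k : nat) (F : 'M[R]_(n, k)).

Fact gram_symmetric : F *m F^T \in @symmetric R n.
Proof. by rewrite unfold_in trmx_mul trmxK. Qed.

Definition gram : symmx R n := SymMx gram_symmetric.

End Gram.

Section Adjoint.
Variables (R : realType) (n m : nat) (A : {linear symmx R n -> 'cV[R]_m}).

Fact symdelta_symmetric (i j : 'I_n) :
  2^-1 *: (delta_mx i j + delta_mx j i) \in @symmetric R n.
Proof. by rewrite unfold_in linearZ linearD /= !trmx_delta addrC. Qed.

Definition symdelta (i j : 'I_n) : symmx R n := SymMx (symdelta_symmetric i j).

Fact adjoint_symmetric (y : 'cV[R]_m) :
  \matrix_(i, j) inner y (A (symdelta i j)) \in @symmetric R n.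
Proof.
rewrite unfold_in; apply/eqP/matrixP=> i j; rewrite !mxE.
by congr (inner y (A _)); apply: val_inj; rewrite /= addrC.
Qed.

(* The entry (i, j) of A^* y is forced by testing the adjunction against the
   symmetric part of the matrix unit E_ij; see [adjointP] and
   [adjoint_unique]. *)
Definition adjoint (y : 'cV[R]_m) : symmx R n := SymMx (adjoint_symmetric y).

End Adjoint.

Section AdjointTheory.
Variables (R : realType) (n m : nat) (A : {linear symmx R n -> 'cV[R]_m}).

Lemma innerE p q (U V : 'M[R]_(p, q)) :
  inner U V = \sum_i \sum_j U i j * V i j.
Proof.
rewrite /inner /mxtrace exchange_big /=; apply: eq_bigr => j _.
by rewrite mxE; apply: eq_bigr => i _; rewrite mxE.
Qed.

Lemma symmx_decomp (X : symmx R n) :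
  X = \sum_i \sum_j (X : 'M[R]_n) i j *: symdelta R i j.
Proof.
apply: val_inj => /=.
have hX : (X : 'M[R]_n)^T = X by apply/eqP; exact: smvalP X.
have sumE (M : 'M[R]_n) : \sum_i \sum_j M i j *: delta_mx j i = M^T.
  rewrite [RHS]matrix_sum_delta exchange_big /=.
  by apply: eq_bigr => i _; apply: eq_bigr => j _; rewrite mxE.
transitivity (2^-1 *: ((X : 'M[R]_n) + (X : 'M[R]_n)^T)).
  by rewrite hX scalerDr -scalerDl -[2^-1]mul1r -splitr scale1r.
rewrite -sumE {1}[smval X]matrix_sum_delta -big_split scaler_sumr /=.
rewrite linear_sum; apply: eq_bigr => i _.
rewrite -big_split scaler_sumr linear_sum; apply: eq_bigr => j _.
by rewrite linearZ /= -scalerDr !scalerA mulrC.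
Qed.

Lemma innerDr p q (U V W : 'M[R]_(p, q)) :
  inner U (V + W) = inner U V + inner U W.
Proof. by rewrite /inner mulmxDr linearD. Qed.

Lemma innerZr p q (U V : 'M[R]_(p, q)) a : inner U (a *: V) = a * inner U V.
Proof. by rewrite /inner -scalemxAr linearZ. Qed.

Lemma inner_sumr p q (U : 'M[R]_(p, q)) (I : finType) (V : I -> 'M[R]_(p, q)) :
  inner U (\sum_i V i) = \sum_i inner U (V i).
Proof. by rewrite /inner mulmx_sumr linear_sum. Qed.

Lemma adjointP (X : symmx R n) (y : 'cV[R]_m) :
  inner (A X) y = inner X (adjoint A y).
Proof.
have innerC p q (U V : 'M[R]_(p, q)) : inner U V = inner V U.
  by rewrite /inner -mxtrace_tr trmx_mul trmxK.
rewrite innerC {1}(symmx_decomp X) linear_sum /= inner_sumr innerE.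
apply: eq_bigr => i _; rewrite linear_sum /= inner_sumr.
by apply: eq_bigr => j _; rewrite linearZ /= innerZr mxE.
Qed.

Lemma adjoint_unique (B : 'cV[R]_m -> symmx R n) :
  (forall X y, inner (A X) y = inner X (B y)) -> B =1 adjoint A.
Proof.
move=> adjB y; set D := B y - adjoint A y.
have DE : smval D = smval (B y) + (-1) *: smval (adjoint A y).
  by rewrite linearB scaleN1r.
have D0 : inner D D = 0.
  by rewrite [X in inner _ X]DE innerDr innerZr -adjB -adjointP mulN1r subrr.
suff /eqP : D = 0 by rewrite subr_eq0 => /eqP.
have sq_ge0 i j : 0 <= (D : 'M[R]_n) i j * (D : 'M[R]_n) i j.
  by rewrite -expr2 sqr_ge0.
apply: val_inj; rewrite raddf0; apply/matrixP => i j; rewrite [RHS]mxE.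
move: D0; rewrite innerE => /eqP; rewrite psumr_eq0; last first.
  by move=> i' _; apply: sumr_ge0 => j' _.
move=> /allP /(_ i); rewrite mem_index_enum /= => /(_ isT).
rewrite psumr_eq0 // => /allP /(_ j); rewrite mem_index_enum /= => /(_ isT).
by rewrite mulf_eq0 orbb => /eqP.
Qed.

End AdjointTheory.

Section SemidefiniteProgram.
Variables (R : realType) (n m : nat).
Variables (C : symmx R n) (A : {linear symmx R n -> 'cV[R]_m}) (b : 'cV[R]_m).

Definition slack (y : 'cV[R]_m) : symmx R n := C - adjoint A y.

Definition primal_feasible (X : symmx R n) : Prop := A X = b /\ psd X.

Definition primal_optimal (X : symmx R n) : Prop :=
  primal_feasible X /\
  forall X' : symmx R n, primal_feasible X' -> inner C X <= inner C X'.

Definition dual_feasible (y : 'cV[R]_m) : Prop := psd (slack y).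

Definition dual_optimal (y : 'cV[R]_m) : Prop :=
  dual_feasible y /\
  forall y' : 'cV[R]_m, dual_feasible y' -> inner b y' <= inner b y.

Definition strong_duality : Prop :=
  (exists X y, primal_optimal X /\ dual_optimal y) /\
  forall X y, primal_optimal X -> dual_optimal y -> inner C X = inner b y.

Definition strict_complementarity : Prop :=
  exists X y, [/\ primal_optimal X, dual_optimal y &
                  (\rank X + \rank (slack y))%N = n].

Definition unique_primal_solution : Prop := exists! X, primal_optimal X.

Definition primal_simple : Prop :=
  [/\ strong_duality, strict_complementarity & unique_primal_solution].

Definition aug_lagrangian (rho : R) (k : nat) (y : 'cV[R]_m)
    (F : 'M[R]_(n, k)) : R :=
  inner C (gram F) + inner y (b - A (gram F))
  + rho / 2 * inner (A (gram F) - b) (A (gram F) - b).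

End SemidefiniteProgram.

Section Minimizers.
Variables (R : realType) (T : topologicalType) (f : T -> R).

Definition local_minimizer (x : T) : Prop := \forall z \near x, f x <= f z.

Definition global_minimizer (x : T) : Prop := forall z, f x <= f z.

Definition spurious_local_minimizer (x : T) : Prop :=
  local_minimizer x /\ ~ global_minimizer x.

End Minimizers.

(* Main.v *)
(* Index the rows by 0, ..., n.  The equations A X = b cut out the affine line
   through Xhat = diag(I_k, 0) and Xstar = e_n e_n^T, whose intersection with
   the cone is the segment [Xhat, Xstar]; the cost C = - k a e_n e_n^T decreases
   strictly from Xhat to Xstar.  A dual certificate is the slack diag(a I_n, 0),
   of rank n, so strict complementarity holds.

   Take y = 0 and Fhat = [I_k; 0].  If F is near Fhat, G is its top k x k block
   and d its last row, the cost is - k a |d|^2, while the off-diagonal block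
   d G^T of F F^T survives in A(F F^T) - b, so the penalty is at least
   (rho/2) |d G^T|^2 >= (rho/8) |d|^2 because G is close to I_k.  Hence Fhat is
   a local minimizer of value 0 once a = rho / (8 k), whereas a factor of Xstar
   has value - k a < 0. *)
Require Import Defs.
From HB Require Import structures.
From mathcomp Require Import all_boot all_order all_algebra.
From mathcomp Require Import boolp classical_sets reals topology normedtype.
From mathcomp Require Import ring lra.
Import Order.TTheory GRing.Theory Num.Theory.
Import numFieldNormedType.Exports.
Local Open Scope ring_scope.

Set Implicit Arguments.
Unset Strict Implicit.
Unset Printing Implicit Defensive.

(** * Trace inner product and positive semidefinite matrices *)

Section Inner.
Variable R : realType.

Lemma innerC p q (U V : 'M[R]_(p, q)) : inner U V = inner V U.
Proof. by rewrite /inner -mxtrace_tr trmx_mul trmxK. Qed.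

Lemma innerDl p q (U V W : 'M[R]_(p, q)) :
  inner (V + W) U = inner V U + inner W U.
Proof. by rewrite !(innerC _ U) innerDr. Qed.

Lemma innerZl p q (U V : 'M[R]_(p, q)) a : inner (a *: V) U = a * inner V U.
Proof. by rewrite !(innerC _ U) innerZr. Qed.

Lemma innerNl p q (U V : 'M[R]_(p, q)) : inner (- V) U = - inner V U.
Proof. by rewrite -scaleN1r innerZl mulN1r. Qed.

Lemma innerNr p q (U V : 'M[R]_(p, q)) : inner U (- V) = - inner U V.
Proof. by rewrite innerC innerNl innerC. Qed.

Lemma inner0l p q (U : 'M[R]_(p, q)) : inner 0 U = 0.
Proof. by rewrite -(scale0r 0) innerZl mul0r. Qed.

Lemma inner_ge0 p q (U : 'M[R]_(p, q)) : 0 <= inner U U.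
Proof.
by rewrite innerE; do 2!apply: sumr_ge0 => ? _; rewrite -expr2 sqr_ge0.
Qed.

Lemma inner_deltal p q (U : 'M[R]_(p, q)) i j : inner (delta_mx i j) U = U i j.
Proof.
rewrite innerE (bigD1 i) //= (bigD1 j) //= mxE !eqxx mul1r.
rewrite !big1 ?addr0 // => [i' /negPf ni|j' /negPf nj].
  by apply: big1 => j' _; rewrite mxE ni mul0r.
by rewrite mxE nj andbF mul0r.
Qed.

(** Flattening is an isometry, so pairings in the codomain of [segment_map] reduce to trace inner
    products of matrices. *)
Lemma inner_mxvec p q (U V : 'M[R]_(p, q)) :
  inner (mxvec U)^T (mxvec V)^T = inner U V.
Proof.
rewrite !innerE [RHS]pair_bigA /=.
under eq_bigr => i _ do rewrite big_ord1 !mxE.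
rewrite (reindex _ (curry_mxvec_bij p q)) /=.
by apply: eq_bigr => -[i j] _; rewrite !mxvecE.
Qed.

Lemma inner_rank_one n (u : 'cV[R]_n) (M : 'M[R]_n) :
  inner (u *m u^T) M = inner u (M *m u).
Proof. by rewrite /inner trmx_mul trmxK -mulmxA mxtrace_mulC mulmxA. Qed.

Lemma smvalB n (X Y : symmx R n) : smval (X - Y) = smval X - smval Y.
Proof. exact: linearB. Qed.

Lemma psd_gram n k (F : 'M[R]_(n, k)) : psd (gram F).
Proof.
move=> v; rewrite (_ : inner _ _ = inner (F^T *m v) (F^T *m v)) ?inner_ge0 //.
by rewrite /inner trmx_mul trmxK !mulmxA.
Qed.

Lemma psd_diag n (X : symmx R n) i : psd X -> 0 <= (X : 'M[R]_n) i i.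
Proof.
move=> /(_ (delta_mx i 0)).
by rewrite -inner_rank_one trmx_delta mul_delta_mx inner_deltal.
Qed.

(** Testing against [symdelta i j] gives the mean of [B i j] and [B j i], which is [B i j] by
    symmetry. Unlike [adjoint_unique], this works for a single [y]. *)
Lemma adjoint_eq n m (A : {linear symmx R n -> 'cV[R]_m}) y (B : symmx R n) :
  (forall X, inner (A X) y = inner X B) -> adjoint A y = B.
Proof.
move=> AB; apply: val_inj; apply/matrixP => i j; rewrite mxE innerC AB /=.
rewrite innerZl innerDl !inner_deltal.
have /eqP/matrixP/(_ i j) : (smval B)^T == B by exact: smvalP B.
by rewrite mxE => ->; lra.
Qed.

End Inner.

(** * A quadratic lower bound near the identity matrix *)

Lemma sum_sqr_le_perturbed (R : realFieldType) (k : nat) (d : 'I_k -> R)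
    (G : 'I_k -> 'I_k -> R) :
  (forall i j, `|G i j - (i == j)%:R| <= (2 * k%:R)^-1) ->
  \sum_j d j ^+ 2 <= 4 * \sum_i (\sum_j d j * G i j) ^+ 2.
Proof.
(* With h = G d, bound <h, d> below by |d|^2 / 2 (entries of G - I are small)
   and above by |h|^2 + |d|^2 / 4. *)
case: k d G => [|k] d G GI; first by rewrite !big_ord0 mulr0.
set e := (2 * k.+1%:R)^-1 in GI.
set S := \sum_j d j ^+ 2; set h := fun i => \sum_j d j * G i j.
have hd_le : \sum_i h i * d i <= \sum_i h i ^+ 2 + 4^-1 * S.
  rewrite mulr_sumr -big_split ler_sum //= => i _.
  by have := sqr_ge0 (h i - d i / 2); lra.
have hd_ge : S - e / 2 * \sum_i \sum_j (d i ^+ 2 + d j ^+ 2) <= \sum_i h i * d i.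
  rewrite mulr_sumr -sumrB; apply: ler_sum => i _.
  have dd : d i ^+ 2 = \sum_j (i == j)%:R * (d i * d j).
    rewrite (bigD1 i) //= eqxx mul1r big1 ?addr0 // => j.
    by rewrite eq_sym => /negPf ->; rewrite mul0r.
  rewrite {1}dd mulr_sumr -sumrB mulr_suml; apply: ler_sum => j _.
  have := GI i j; rewrite ler_norml => /andP[G1 G2].
  (* With x = G_ij - delta_ij, adding (e + x)(d_i + d_j)^2 >= 0 and (e - x)(d_i - d_j)^2 >= 0 gives
     x d_i d_j >= - (e/2)(d_i^2 + d_j^2). *)
  have Ge : 0 <= e + (G i j - (i == j)%:R) by lra.
  have Ge' : 0 <= e - (G i j - (i == j)%:R) by lra.
  have := mulr_ge0 Ge (sqr_ge0 (d i + d j)).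
  have := mulr_ge0 Ge' (sqr_ge0 (d i - d j)).
  lra.
have SS : \sum_i \sum_j (d i ^+ 2 + d j ^+ 2) = 2 * k.+1%:R * S.
  under eq_bigr => i _ do rewrite big_split /= sumr_const card_ord -mulr_natl.
  rewrite big_split /= -mulr_sumr sumr_const card_ord -mulr_natl.
  by rewrite -/S; ring.
have e2 : e * (2 * k.+1%:R) = 1 by rewrite mulVf // mulf_neq0 ?pnatr_eq0.
(* The tolerance [e] makes the error exactly S/2, whence S/2 <= |h|^2 + S/4. *)
move: hd_ge; rewrite SS (_ : e / 2 * _ = 2^-1 * S); last first.
  by transitivity (e * (2 * k.+1%:R) * (2^-1 * S)); [ring|rewrite e2 mul1r].
rewrite -/(h _); lra.
Qed.

(** * The linear map and the ends of its feasible segment *)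

Section Construction.
Variables (R : realType) (n k : nat).
Hypotheses (k_gt0 : (0 < k)%N) (le_kn : (k <= n)%N).

Definition spurious_factor : 'M[R]_(n.+1, k) := pid_mx k.
(** As a Gram matrix, it makes A(Fhat Fhat^T) = b hold by the very definition of [rhs]. *)
Definition head : symmx R n.+1 := gram spurious_factor.
Definition corner : symmx R n.+1 :=
  gram (delta_mx ord_max 0 : 'cV[R]_n.+1).

Lemma headE : head = pid_mx k :> 'M[R]_n.+1.
Proof. by rewrite /= tr_pid_mx pid_mx_id. Qed.

Lemma cornerE : corner = delta_mx ord_max ord_max :> 'M[R]_n.+1.
Proof. by rewrite /= trmx_delta mul_delta_mx. Qed.

Lemma head_entry i j :
  (head : 'M[R]_n.+1) i j = ((i == j :> nat) && (i < k)%N)%:R.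
Proof. by rewrite headE mxE. Qed.

Lemma corner_entry i j :
  (corner : 'M[R]_n.+1) i j = ((i == ord_max) && (j == ord_max))%:R.
Proof. by rewrite cornerE mxE. Qed.

(* The kernel of this map is the line spanned by [head - corner]. *)
Definition segment_map (X : symmx R n.+1) : 'cV[R]_(n.+1 * n.+1) :=
  (mxvec (smval X + smval X ord_max ord_max *: (smval head - smval corner)))^T.

Fact segment_map_is_linear : linear segment_map.
Proof.
move=> a X Y; rewrite /segment_map; move: (smval head - _) => W.
rewrite [X in mxvec X](_ : _ = a *: (smval X + smval X ord_max ord_max *: W) +
  (smval Y + smval Y ord_max ord_max *: W)); first by rewrite !linearP.
rewrite linearP /= !mxE scalerDl scalerDr scalerA.
by rewrite addrACA.
Qed.

HB.instance Definition _ := GRing.isLinear.Build R (symmx R n.+1)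
  'cV[R]_(n.+1 * n.+1) *:%R segment_map segment_map_is_linear.

Lemma head_last : (head : 'M[R]_n.+1) ord_max ord_max = 0.
Proof. by rewrite head_entry eqxx ltnNge le_kn. Qed.

Lemma corner_last : (corner : 'M[R]_n.+1) ord_max ord_max = 1.
Proof. by rewrite corner_entry !eqxx. Qed.

Lemma segment_map_head : segment_map head = (mxvec (smval head))^T.
Proof. by rewrite /segment_map head_last scale0r addr0. Qed.

Lemma segment_map_corner : segment_map corner = (mxvec (smval head))^T.
Proof. by rewrite /segment_map corner_last scale1r addrC subrK. Qed.

Lemma inner_corner (M : 'M[R]_n.+1) : inner corner M = M ord_max ord_max.
Proof. by rewrite cornerE inner_deltal. Qed.

(** * Cost, dual certificate and primal simplicity *)

Variables (a : R) (a_gt0 : 0 < a).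

Definition cost : symmx R n.+1 := - (k%:R * a) *: corner.
Definition rhs : 'cV[R]_(n.+1 * n.+1) := segment_map head.
Definition dual_point : 'cV[R]_(n.+1 * n.+1) :=
  (mxvec (- a *: (pid_mx n : 'M[R]_n.+1)))^T.

Lemma smval_cost : cost = - (k%:R * a) *: smval corner :> 'M[R]_n.+1.
Proof. by rewrite /cost linearZ. Qed.

Lemma inner_cost (X : symmx R n.+1) :
  inner cost X = - (k%:R * a) * (X : 'M[R]_n.+1) ord_max ord_max.
Proof. by rewrite smval_cost innerZl inner_corner. Qed.

Lemma inner_head_pid : inner head (pid_mx n : 'M[R]_n.+1) = k%:R.
Proof.
rewrite headE /inner tr_pid_mx mul_pid_mx; have /minn_idPl -> := le_kn.
(* Factoring diag(I_k, 0) through R^k lets cyclicity turn its trace into that of I_k. *)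
rewrite (minn_idPr _) ?leqW // -(@pid_mx_id _ n.+1 k n.+1 k) //.
by rewrite mxtrace_mulC pid_mx_id ?leqW // pid_mx_1 mxtrace1.
Qed.

(** Here A^* y = - a (diag(I_n, 0) + k e_n e_n^T), where k is the pairing of [head - corner] with
    diag(I_n, 0). The factor k in the cost is chosen to cancel the last term. *)
Lemma slack_dual_point :
  slack cost segment_map dual_point = a *: (pid_mx n) :> 'M[R]_n.+1.
Proof.
have Bsym : - a *: (pid_mx n + k%:R *: smval corner) \in @Defs.symmetric R n.+1.
  by rewrite unfold_in cornerE linearZ linearD linearZ /= tr_pid_mx trmx_delta.
rewrite /slack (@adjoint_eq _ _ _ _ _ (SymMx Bsym)).
  rewrite smvalB smval_cost.
  rewrite -[smval (SymMx _)]/(- a *: (pid_mx n + k%:R *: smval corner)).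
  by rewrite !scaleNr opprK scalerDr scalerA (mulrC a) addrC addrK.
move=> X /=; rewrite inner_mxvec !innerZr innerDl innerZl innerDl innerNl.
rewrite inner_head_pid inner_corner mxE ltnn andbF subr0.
rewrite innerDr innerZr [inner (smval X) (gram _)]innerC inner_corner.
by rewrite (mulrC k%:R).
Qed.

(** The equations say X = (1 - t) head + t corner; the entry (0, 0) of X is then 1 - t, as k and n
    are positive, and it is nonnegative. *)
Lemma feasible_segment X : primal_feasible segment_map rhs X ->
  let t := (X : 'M[R]_n.+1) ord_max ord_max in
  smval X = smval head - t *: (smval head - smval corner) /\ t <= 1.
Proof.
move=> [AX Xpsd] t.
have Xt : smval X = smval head - t *: (smval head - smval corner).
  move: AX; rewrite /rhs segment_map_head => /trmx_inj /(can_inj mxvecK) AX.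
  by apply/eqP; rewrite eq_sym subr_eq AX.
split=> //; have n_gt0 : (0 < n)%N := leq_trans k_gt0 le_kn.
have combE (H K : 'M[R]_n.+1) i j :
  (H - t *: (H - K)) i j = H i j - t * (H i j - K i j) by rewrite !mxE.
move: (psd_diag ord0 Xpsd); rewrite Xt combE head_entry corner_entry.
by rewrite eqxx k_gt0 -val_eqE /= ltn_eqF //=; lra.
Qed.

(** On the segment the cost is - k a t with t <= 1. *)
Lemma corner_optimal : primal_optimal cost segment_map rhs corner.
Proof.
split.
  by split; [rewrite /= segment_map_corner -segment_map_head|exact: psd_gram].
move=> X /feasible_segment[_ t1]; rewrite !inner_cost corner_last mulr1.
by rewrite !mulNr lerN2 ler_piMr // mulr_ge0 // ltW.
Qed.

(** Comparing costs with [corner] forces t >= 1, hence t = 1. *)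
Lemma optimal_eq_corner X : primal_optimal cost segment_map rhs X -> X = corner.
Proof.
move=> [/feasible_segment[Xt t1] /(_ _ corner_optimal.1)].
rewrite !inner_cost corner_last mulr1 mulNr lerN2.
rewrite -[leLHS]mulr1 ler_pM2l; last by rewrite mulr_gt0 ?ltr0n.
move=> t1'; apply: val_inj; rewrite [LHS]Xt.
by rewrite (le_anti (introT andP (conj t1 t1'))) scale1r opprB addrC subrK.
Qed.

(** Weak duality at [corner]: the last diagonal entry of the slack is - k a - <b, y>. *)
Lemma inner_rhs_le y : dual_feasible cost segment_map y ->
  inner rhs y <= - (k%:R * a).
Proof.
move=> /(psd_diag ord_max); rewrite -inner_corner /slack smvalB.
rewrite innerDr innerNr -adjointP [inner corner _]innerC inner_cost corner_last.
have -> : inner (segment_map corner) y = inner rhs y.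
  by rewrite segment_map_corner -segment_map_head.
by rewrite mulr1; lra.
Qed.

Lemma inner_rhs_dual_point : inner rhs dual_point = - (k%:R * a).
Proof.
by rewrite /rhs segment_map_head inner_mxvec innerZr inner_head_pid mulNr mulrC.
Qed.

Lemma dual_point_optimal : dual_optimal cost segment_map rhs dual_point.
Proof.
split; last by move=> y /inner_rhs_le; rewrite inner_rhs_dual_point.
move=> v; rewrite slack_dual_point -scalemxAl innerZr.
apply: mulr_ge0; first exact: ltW.
(* diag(I_n, 0) is its own Gram matrix. *)
have := psd_gram (pid_mx n : 'M[R]_n.+1) v.
by rewrite /= tr_pid_mx pid_mx_id.
Qed.

Lemma construction_primal_simple : primal_simple cost segment_map rhs.
Proof.
have [Xopt yopt] := (corner_optimal, dual_point_optimal).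
split.
- split; first by exists corner, dual_point.
  move=> X y /optimal_eq_corner -> [yfeas ymax].
  rewrite inner_cost corner_last mulr1; apply: le_anti.
  by rewrite inner_rhs_le // -inner_rhs_dual_point ymax //; case: yopt.
- exists corner, dual_point; split=> //.
  rewrite slack_dual_point cornerE mxrank_delta mxrank_scale_nz ?gt_eqF //.
  by rewrite rank_pid_mx.
- exists corner; split=> //.
  by move=> X /optimal_eq_corner.
Qed.

(** * The augmented Lagrangian at the zero multiplier *)

Lemma aug_lagrangian0 rho (F : 'M[R]_(n.+1, k)) :
  let r := segment_map (gram F) - rhs in
  aug_lagrangian cost segment_map rhs rho 0 F =
  rho / 2 * inner r r - (k%:R * a) * \sum_j F ord_max j ^+ 2.
Proof.
rewrite /aug_lagrangian inner_cost inner0l addr0 addrC mulNr /= mxE.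
congr (_ - _ * _).
by apply: eq_bigr => j _; rewrite mxE expr2.
Qed.

(** Only the entries (n, j) with j < k of the residual are kept. Both [head] and [corner] vanish
    there, so these are the entries of F F^T. *)
Lemma residual_ge (F : 'M[R]_(n.+1, k)) :
  let r := segment_map (gram F) - rhs in
  \sum_(j < k) (\sum_l F ord_max l * F (widen_ord (leqW le_kn) j) l) ^+ 2
    <= inner r r.
Proof.
rewrite /= /rhs segment_map_head /segment_map -!linearB /= inner_mxvec.
set M := (X in inner X X).
have ME (j : 'I_k) : M ord_max (widen_ord (leqW le_kn) j) =
    \sum_l F ord_max l * F (widen_ord (leqW le_kn) j) l.
  have jn : (j < n)%N := leq_trans (ltn_ord j) le_kn.
  have combE (P H K : 'M[R]_n.+1) t i i' :
    (P + t *: (H - K) - H) i i' = P i i' + t * (H i i' - K i i') - H i i'.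
    by rewrite !mxE.
  rewrite /M combE head_entry corner_entry -!val_eqE /=.
  rewrite (gtn_eqF jn) (ltn_eqF jn) andbF subrr mulr0 addr0 subr0 mxE.
  by apply: eq_bigr => l _; rewrite mxE.
rewrite innerE (bigD1 ord_max) //= -[leLHS]addr0 lerD //; last first.
  by do 2!apply: sumr_ge0 => ? _; rewrite -expr2 sqr_ge0.
under eq_bigr => j _ do rewrite -ME.
(* The sum over j < k is extended by zero to all columns, to be compared with the last row of
   [M]. *)
rewrite -(big_ord_narrow (F := fun j => M ord_max j ^+ 2) (leqW le_kn)).
rewrite big_mkcond ler_sum // => j _; case: ifP => _; first by rewrite expr2.
by rewrite -expr2 sqr_ge0.
Qed.

Lemma spurious_factor_entry i j :
  spurious_factor i j = ((i == j :> nat) && (i < k)%N)%:R.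
Proof. by rewrite mxE. Qed.

Lemma aug_lagrangian_spurious_factor rho :
  aug_lagrangian cost segment_map rhs rho 0 spurious_factor = 0.
Proof.
rewrite aug_lagrangian0 -/head -/rhs subrr inner0l big1 ?mulr0 ?subrr // => j _.
by rewrite spurious_factor_entry ltnNge le_kn andbF expr0n.
Qed.

(** With S the squared norm of the last row and r the residual, k a S <= 4 k a |r|^2 <= (rho/2)
    |r|^2. *)
Lemma spurious_factor_local (rho : R) : 8 * k%:R * a <= rho ->
  local_minimizer (aug_lagrangian cost segment_map rhs rho 0) spurious_factor.
Proof.
move=> a_le.
have e_gt0 : 0 < (2 * k%:R)^-1 :> R by rewrite invr_gt0 mulr_gt0 ?ltr0n.
(* Matrix balls are entrywise, so this radius is the tolerance of [sum_sqr_le_perturbed]. *)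
apply: filterS (nbhsx_ballx spurious_factor _ e_gt0) => F Fnear.
rewrite aug_lagrangian_spurious_factor aug_lagrangian0.
set S := \sum_j _; set r := (X in inner X _).
have S_le : S <= 4 * inner r r.
  apply: (@le_trans _ _ (4 * \sum_(j < k)
    (\sum_l F ord_max l * F (widen_ord (leqW le_kn) j) l) ^+ 2)); last first.
    by rewrite ler_pM2l //; exact: residual_ge.
  apply: sum_sqr_le_perturbed => i j.
  have := Fnear.2 (widen_ord (leqW le_kn) i) j.
  rewrite /ball /= spurious_factor_entry /= ltn_ord andbT distrC.
  exact: ltW.
have ka_ge0 : 0 <= k%:R * a by rewrite mulr_ge0 // ltW.
have := ler_wpM2l ka_ge0 S_le.
have := ler_wpM2r (inner_ge0 r) a_le.
move: (inner r r) k%:R (S) => *; lra.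
Qed.

(** Placing e_n in one column and zeros elsewhere factors [corner]: the residual is zero and the
    value is - k a. *)
Lemma spurious_factor_not_global (rho : R) :
  ~ global_minimizer (aug_lagrangian cost segment_map rhs rho 0) spurious_factor.
Proof.
pose j0 := Ordinal k_gt0.
have gram_corner : gram (delta_mx ord_max j0 : 'M[R]_(n.+1, k)) = corner.
  by apply: val_inj; rewrite [RHS]cornerE /= trmx_delta mul_delta_mx.
move=> /(_ (delta_mx ord_max j0)).
rewrite aug_lagrangian_spurious_factor aug_lagrangian0 gram_corner.
rewrite segment_map_corner -segment_map_head subrr inner0l.
rewrite (bigD1 j0) //= big1 => [|j /negPf nj]; last first.
  by rewrite mxE nj andbF expr0n.
have : 0 < k%:R * a by rewrite mulr_gt0 ?ltr0n.
by rewrite mxE !eqxx expr1n mulr0 addr0 mulr1 sub0r oppr_ge0 leNgt => ->.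
Qed.

End Construction.

(** * Choice of the parameters *)

Theorem mainTheorem7 (R : realType) (n : nat) (hn : (2 <= n)%N)
    (rho : R) (hrho : 0 < rho) (k : nat) (hk : (1 <= k <= n - 1)%N) :
  exists (m : nat) (C : symmx R n) (A : {linear symmx R n -> 'cV[R]_m})
         (b : 'cV[R]_m),
    [/\ primal_simple C A b,
        exists X : symmx R n, primal_optimal C A b X /\ \rank X = 1%N
      & exists (y : 'cV[R]_m) (F : 'M[R]_(n, k)),
          [/\ spurious_local_minimizer (aug_lagrangian C A b rho y) F,
              \rank F = k
            & A (gram F) = b]].
Proof.
case: n hn hk => // n _; rewrite subn1 /= => /andP[k_gt0 le_kn].
(* This is the largest a with 8 k a <= rho. The inferred m is the number of entries of a flattened
   matrix. *)
have a_gt0 : 0 < rho / (8 * k%:R) by rewrite divr_gt0 // mulr_gt0 ?ltr0n.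
exists _, (cost n k (rho / (8 * k%:R))), (segment_map k), (rhs R n k).
split; first exact: construction_primal_simple.
  exists (corner R n); split; first exact: corner_optimal.
  by rewrite cornerE mxrank_delta.
exists 0, (spurious_factor R n k); split=> //; last first.
  by rewrite rank_pid_mx // leqW.
split; last exact: spurious_factor_not_global.
apply: spurious_factor_local => //.
by rewrite mulrC divfK // mulf_neq0 ?pnatr_eq0 -?lt0n.
Qed.
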